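(* The path length restricted version of the MSP problem, in which each logical path is restricted to use at most $K$ fibers, can be solved in polynomial time (in the number $m$ of fibers).
   Context: A layered network consists of a physical topology, a finite graph $G_P=(V_P,E_P)$ whose $m$ links are called fibers, and a logical topology, a finite graph $G_L=(V_L,E_L)$ with $V_L\subseteq V_P$, together with a lightpath routing that maps each logical link $(i,j)\in E_L$ to an $i$-$j$ path in $G_P$. Let $s\neq t$ be two nodes of $V_L$. A logical path is an $s$-$t$ path in $G_L$; it uses a fiber if some logical link on it is routed over that fiber. A logical path survives a fiber if it does not use that fiber. A set of logical $s$-$t$ paths is survivable if for every fiber at least one path of the set survives that fiber. The MSP problem is to find a survivable path set of minimum cardinality. In the path length restricted version only logical $s$-$t$ paths that use at most $K$ fibers are admissible, where $K$ is a fixed constant. *)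

(* Defs.v *)
From mathcomp Require Import all_boot all_algebra.

Set Implicit Arguments.
Unset Strict Implicit.
Unset Printing Implicit Defensive.

(** * Polynomial time

The machine model is Jones' WHILE language (N. D. Jones, "Computability and
Complexity from a Programming Perspective"): imperative programs over binary
trees, every elementary operation being charged one step.  It is polynomially
equivalent to Turing machines.  Leaves may also carry atoms, which serve as
vertex names.  Programs cannot create, order or decompose atoms; they can only
copy them and compare two of them for equality, in unit time as is usual for
graph algorithms. *)

Inductive tree : Type := Nil | Atom of nat | Cons of tree & tree.

Inductive expr : Type :=
| EVar of nat
| ENil
| ECons of expr & expr
| EHd of expr
| ETl of expr
| EEq of expr & expr.

Inductive cmd : Type :=
| Assign of nat & expr
| Seq of cmd & cmd
| If of expr & cmd & cmd
| While of expr & cmd.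

Definition store := nat -> tree.

Definition update (s : store) (x : nat) (d : tree) : store :=
  fun y => if y == x then d else s y.

(* [Nil] is false, every other tree is true. *)
Definition truth (d : tree) : bool := if d is Nil then false else true.

Definition hd (d : tree) : tree := if d is Cons a _ then a else Nil.
Definition tl (d : tree) : tree := if d is Cons _ b then b else Nil.

(* Only leaves are compared: testing whole trees in one step would not be a
   realistic elementary operation. *)
Definition leaf_eq (d1 d2 : tree) : tree :=
  match d1, d2 with
  | Nil, Nil => Cons Nil Nil
  | Atom a, Atom b => if a == b then Cons Nil Nil else Nil
  | _, _ => Nil
  end.

Fixpoint eval (s : store) (e : expr) : tree :=
  match e with
  | EVar x => s x
  | ENil => Nil
  | ECons e1 e2 => Cons (eval s e1) (eval s e2)
  | EHd e1 => hd (eval s e1)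
  | ETl e1 => tl (eval s e1)
  | EEq e1 e2 => leaf_eq (eval s e1) (eval s e2)
  end.

Fixpoint cost (e : expr) : nat :=
  match e with
  | EVar _ | ENil => 1
  | ECons e1 e2 | EEq e1 e2 => (cost e1 + cost e2).+1
  | EHd e1 | ETl e1 => (cost e1).+1
  end.

(* [exec c s s' t]: started in [s], [c] halts in [s'] after [t] steps. *)
Inductive exec : cmd -> store -> store -> nat -> Prop :=
| ExecAssign x e s :
    exec (Assign x e) s (update s x (eval s e)) (cost e).+1
| ExecSeq c1 c2 s1 s2 s3 t1 t2 :
    exec c1 s1 s2 t1 -> exec c2 s2 s3 t2 -> exec (Seq c1 c2) s1 s3 (t1 + t2)
| ExecIfTrue e c1 c2 s s' t :
    truth (eval s e) -> exec c1 s s' t ->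
    exec (If e c1 c2) s s' ((cost e).+1 + t)
| ExecIfFalse e c1 c2 s s' t :
    ~~ truth (eval s e) -> exec c2 s s' t ->
    exec (If e c1 c2) s s' ((cost e).+1 + t)
| ExecWhileTrue e c s1 s2 s3 t1 t2 :
    truth (eval s1 e) -> exec c s1 s2 t1 -> exec (While e c) s2 s3 t2 ->
    exec (While e c) s1 s3 ((cost e).+1 + t1 + t2)
| ExecWhileFalse e c s :
    ~~ truth (eval s e) -> exec (While e c) s s (cost e).+1.

(* Input and output are both in variable 0; all other variables start at
   [Nil]. *)
Definition run (c : cmd) (input output : tree) (t : nat) : Prop :=
  exists s : store,
    exec c (update (fun _ => Nil) 0 input) s t /\ s 0 = output.

(* Execution is deterministic, so an existing run is the only one. *)
Lemma exec_det c s s1 s2 t1 t2 :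
  exec c s s1 t1 -> exec c s s2 t2 -> s1 = s2 /\ t1 = t2.
Proof.
move=> h; elim: h s2 t2 => {c s s1 t1} *;
match goal with H : exec _ _ ?s ?t |- _ = ?s /\ _ = ?t => inversion H end;
subst => //; try by match goal with
  | H : is_true (truth ?d), H' : is_true (~~ truth ?d) |- _ => rewrite H in H'
  end.
all: repeat match goal with
  | IH : forall s t, exec ?c ?s0 s t -> _, H : exec ?c ?s0 _ _ |- _ =>
    have [? ?] := IH _ _ H; clear IH; subst
  end; by [].
Qed.

(* One program handles all instances.  The answer type may depend on the
   instance [i], and [sol i a] says that [a] is a correct answer for [i].
   The time bound is polynomial in the parameter [m i]. *)
Definition polytime_solvable (I : Type) (A : I -> Type)
    (encI : I -> tree) (encA : forall i : I, A i -> tree)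
    (sol : forall i : I, A i -> Prop) (m : I -> nat) : Prop :=
  exists (c : cmd) (p : {poly nat}), forall i : I,
  exists (a : A i) (t : nat),
    [/\ sol i a, run c (encI i) (encA i a) t & t <= p.[m i]%R].

(** * Layered networks

Graphs are simple and undirected, given by a set of 2-element vertex sets.
A path is the sequence of the vertices that it visits, without repetition. *)

Section Paths.
Variable V : finType.
Implicit Types (E : {set {set V}}) (p : seq V).

Definition simple_graph E : Prop := forall e : {set V}, e \in E -> #|e| = 2.

Definition path_links p : seq {set V} :=
  if p is x :: q then pairmap (fun u v => [set u; v]) x q else [::].

Definition is_path E (x y : V) p : bool :=
  if p is x' :: q then
    [&& x' == x, last x' q == y, uniq p & all (mem E) (path_links p)]
  else false.

End Paths.

(* The routing of a logical link is an undirected path, recorded in one of its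
   two directions; values of [routing] outside [llinks] are irrelevant. *)
Record layered_network : Type := LayeredNetwork {
  node : finType;
  fibers : {set {set node}};
  lnodes : {set node};
  llinks : {set {set node}};
  routing : {set node} -> seq node;
  src : node;
  dst : node;
  fibers_simple : simple_graph fibers;
  llinks_simple : simple_graph llinks;
  llinks_sub : forall e : {set node}, e \in llinks -> e \subset lnodes;
  routingP : forall e : {set node}, e \in llinks ->
    exists i j : node, e = [set i; j] /\ is_path fibers i j (routing e);
  src_lnode : src \in lnodes;
  dst_lnode : dst \in lnodes;
  src_neq_dst : src != dst }.

Definition num_fibers (N : layered_network) : nat := #|fibers N|.

Section MSP.
Variables (N : layered_network) (K : nat).
Implicit Types (P : seq (node N)) (S : seq (seq (node N))).

Definition logical_path P : bool := is_path (llinks N) (src N) (dst N) P.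

Definition used_fibers P : {set {set node N}} :=
  [set f in fibers N |
    has (fun e => f \in path_links (routing e)) (path_links P)].

Definition survives P (f : {set node N}) : bool := f \notin used_fibers P.

Definition admissible P : bool := logical_path P && (#|used_fibers P| <= K).

Definition survivable S : Prop :=
  forall f : {set node N}, f \in fibers N -> exists2 P, P \in S & survives P f.

(* Finite sets of paths are duplicate-free lists. *)
Definition admissible_survivable_set S : Prop :=
  [/\ uniq S, all admissible S & survivable S].

(* [None] answers that there is no survivable set of admissible paths. *)
Definition restricted_MSP_answer (a : option (seq (seq (node N)))) : Prop :=
  match a with
  | Some Ps => admissible_survivable_set Ps /\
      forall S, admissible_survivable_set S -> size Ps <= size S
  | None => forall S, ~ admissible_survivable_set S
  end.

End MSP.

(** * Encodings *)

Fixpoint enc_list (l : seq tree) : tree :=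
  if l is d :: l' then Cons d (enc_list l') else Nil.

Section Encoding.
Variable N : layered_network.

Definition enc_node (x : node N) : tree := Atom (enum_rank x).

Definition enc_path (p : seq (node N)) : tree := enc_list (map enc_node p).

Definition enc_set (A : {set node N}) : tree := enc_path (enum A).

Definition enc_llink (e : {set node N}) : tree :=
  Cons (enc_set e) (enc_path (routing e)).

Definition enc_network : tree :=
  enc_list [:: enc_set [set: node N];
               enc_list (map enc_set (enum (fibers N)));
               enc_set (lnodes N);
               enc_list (map enc_llink (enum (llinks N)));
               enc_node (src N);
               enc_node (dst N)].

Definition enc_answer (a : option (seq (seq (node N)))) : tree :=
  if a is Some Ps then Cons (enc_list (map enc_path Ps)) Nil else Nil.

End Encoding.

(* Main.v *)
Require Import Defs.
From mathcomp Require Import all_boot all_algebra.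
From mathcomp Require Import zify.
(* Imported again so that [Cons] denotes the tree constructor. *)
Require Import Defs.

(** Exhaustive search is polynomial for a fixed K, because both the admissible
paths and the useful sets of such paths have bounded size.

A logical link joins two distinct nodes, so its lightpath crosses a fiber and
both of its ends are ends of fibers.  As the source and the destination differ,
every node of a logical path lies on a logical link of that path, hence on a
fiber that the path uses.  An admissible path therefore visits at most 2K
nodes, all of them ends of fibers ([admissible_size], [admissible_nodes]), and
there are polynomially many such node sequences.

Among survivable sets of admissible paths the smallest have at most K + 1 paths: keep any path
P of a survivable set, and for each of the at most K fibers that P uses keep one
path of the set that survives this fiber ([small_survivable]).  Listing the
sequences of at most K + 1 admissible paths by increasing length, the first
survivable one is optimal; it has no duplicates, since removing them would give
a shorter one ([ohead_solutions_correct]).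

The complexity claim rests on a small calculus of tree functions that are
computed, with polynomial time and output size, by a program working in
registers n, n + 1, and so on, whatever these contain ([feasible]).  The class
is closed under composition, pairing, conditionals and iteration over a list
when each iteration enlarges the accumulator only by an amount that does not
depend on the accumulator ([feasible_fold]).  Maps, filters, quantifiers over
lists and, for each fixed k, the enumeration of the words of length k follow
from these closures, and so does the whole search ([feasible_answer]).

The time bound is in the number m of fibers, whereas the encoded network also
lists all nodes, whose number is unrelated to m.  The program first discards
these node lists, which takes constant time.  What remains has size polynomial
in m, because there are at most (2m)^2 logical links, each routed through at
most 2m nodes ([tsize_instance]). *)

Set Implicit Arguments.
Unset Strict Implicit.
Unset Printing Implicit Defensive.
Import GRing.Theory.

(** * Polynomials over the natural numbers *)

Lemma horner_mono (p : {poly nat}) (m n : nat) : m <= n -> p.[m]%R <= p.[n]%R.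
Proof.
move=> le_mn; rewrite !horner_coef; apply: leq_sum => i _.
by apply: leq_mul => //; elim: (i : nat) => // k IH; rewrite !exprS leq_mul.
Qed.

(** The horner rules, restated with the operations of [nat] in their conclusions,
which is the form that linear arithmetic needs. *)
Lemma horner_addn (p q : {poly nat}) (n : nat) :
  (p + q).[n]%R = p.[n]%R + q.[n]%R.
Proof. exact: hornerD. Qed.

Lemma horner_muln (p q : {poly nat}) (n : nat) :
  (p * q).[n]%R = p.[n]%R * q.[n]%R.
Proof. exact: hornerM. Qed.

Lemma horner_compn (p q : {poly nat}) (n : nat) :
  (p \Po q).[n]%R = p.[q.[n]%R]%R.
Proof. exact: horner_comp. Qed.

Lemma horner_Xn (n : nat) : ('X : {poly nat}).[n]%R = n.
Proof. exact: hornerX. Qed.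

Lemma horner_Cn (c n : nat) : (c%:P : {poly nat}).[n]%R = c.
Proof. exact: hornerC. Qed.

Definition nhorner :=
  (horner_addn, horner_muln, horner_compn, horner_Xn, horner_Cn).

(** * Feasible functions on trees *)

Fixpoint tsize (d : tree) : nat :=
  if d is Cons a b then (tsize a + tsize b).+1 else 1.

(** The program depends on the register [n] that holds its argument and receives
its result.  It may use any register from [n] on, without assumption on the
initial contents, and preserves those below [n]: this is what lets programs
call each other, since a fresh program never finds its registers clean.  Time
and output size are bounded together because sharing makes them independent:
the tree [Cons x x] is built in constant time. *)
Definition feasible (f : tree -> tree) : Prop :=
  exists (c : nat -> cmd) (p : {poly nat}), forall (n : nat) (s : store),
  exists (s' : store) (t : nat),
    [/\ exec (c n) s s' t, s' n = f (s n), forall y, y < n -> s' y = s y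
      & t + tsize (f (s n)) <= p.[tsize (s n)]%R].

Lemma feasible_ext (f g : tree -> tree) : f =1 g -> feasible f -> feasible g.
Proof.
move=> fg [c [p h]]; exists c, p => n s.
by have [s' [t]] := h n s; rewrite fg; exists s', t.
Qed.

Lemma feasible_size f :
  feasible f -> exists q : {poly nat}, forall d, tsize (f d) <= q.[tsize d]%R.
Proof.
move=> [c [p h]]; exists p => d.
have [s' [t [_ _ _]]] := h 0 (fun=> d); exact/leq_trans/leq_addl.
Qed.

Lemma update_same s x d : update s x d x = d.
Proof. by rewrite /update eqxx. Qed.

Lemma update_neq s x d y : y != x -> update s x d y = s y.
Proof. by rewrite /update => /negPf->. Qed.

(** The second program runs on the output of the first, so that its time is
polynomial in the input only thanks to the bound on output sizes. *)
Lemma feasible_comp f g :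
  feasible f -> feasible g -> feasible (fun d => g (f d)).
Proof.
move=> [c [p hf]] [c' [p' hg]].
exists (fun n => Seq (c n) (c' n)), (p + (p' \Po p))%R => n s.
have [s1 [t1 [e1 r1 o1 b1]]] := hf n s.
have [s2 [t2 [e2 r2 o2 b2]]] := hg n s1.
exists s2, (t1 + t2); split; first exact: ExecSeq e1 e2.
- by rewrite r2 r1.
- by move=> y lt_yn; rewrite o2 // o1.
rewrite !nhorner -addnA; apply: leq_add; first by lia.
rewrite -r1; apply: leq_trans b2 _; rewrite r1; apply: horner_mono; lia.
Qed.

Lemma feasible_expr (e : nat -> expr) (f : tree -> tree) (k : nat) :
  (forall n s, eval s (e n) = f (s n)) -> (forall n, cost (e n) < k) ->
  (forall d, tsize (f d) <= tsize d + k) -> feasible f.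
Proof.
move=> ef ek fk; exists (fun n => Assign n (e n)), ('X + (k + k)%:P)%R => n s.
exists (update s n (eval s (e n))), (cost (e n)).+1; split.
- exact: ExecAssign.
- by rewrite update_same.
- by move=> y lt_yn; rewrite update_neq // neq_ltn lt_yn.
by rewrite !nhorner; have := fk (s n); have := ek n; lia.
Qed.

Lemma feasible_id : feasible id.
Proof. by apply: (@feasible_expr EVar _ 2) => //= d; lia. Qed.

Lemma feasible_nil : feasible (fun=> Nil).
Proof. by apply: (@feasible_expr (fun=> ENil) _ 2) => //= d; lia. Qed.

Lemma feasible_hd f : feasible f -> feasible (fun d => hd (f d)).
Proof.
move=> ff; apply: (feasible_comp ff).
by apply: (@feasible_expr (fun n => EHd (EVar n)) _ 3) => // -[|a|a b] /=; lia.
Qed.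

Lemma feasible_tl f : feasible f -> feasible (fun d => tl (f d)).
Proof.
move=> ff; apply: (feasible_comp ff).
by apply: (@feasible_expr (fun n => ETl (EVar n)) _ 3) => // -[|a|a b] /=; lia.
Qed.

(** The argument is saved by working upwards: [g] is computed in register
[n + 1] from a copy, then [f] in register [n + 2] from a second copy. *)
Lemma feasible_cons f g :
  feasible f -> feasible g -> feasible (fun d => Cons (f d) (g d)).
Proof.
move=> [c [p hf]] [c' [p' hg]].
exists (fun n => Seq (Assign n.+1 (EVar n)) (Seq (c' n.+1)
         (Seq (Assign n.+2 (EVar n)) (Seq (c n.+2)
            (Assign n (ECons (EVar n.+2) (EVar n.+1))))))),
  (p + p' + 9%N%:P)%R.
move=> n s.
set s1 := update s n.+1 (s n).
have [s2 [t2 [e2 r2 o2 b2]]] := hg n.+1 s1.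
set s3 := update s2 n.+2 (s2 n).
have [s4 [t4 [e4 r4 o4 b4]]] := hf n.+2 s3.
exists (update s4 n (Cons (s4 n.+2) (s4 n.+1))), (2 + (t2 + (2 + (t4 + 4)))).
have q2 : s2 n = s n by rewrite o2 // /s1 update_neq // neq_ltn ltnSn.
have q1 : s1 n.+1 = s n by exact: update_same.
have q3 : s3 n.+2 = s n by rewrite /s3 update_same q2.
have q4 : s4 n.+1 = g (s n).
  by rewrite o4 // /s3 update_neq ?r2 ?q1 // neq_ltn ltnSn.
split.
- do 4! [apply: ExecSeq; [exact: ExecAssign || eassumption|]]; exact: ExecAssign.
- by rewrite update_same r4 q4 q3.
- move=> y lt_yn; rewrite update_neq ?neq_ltn ?lt_yn // o4; last by lia.
  rewrite /s3 update_neq; last by lia.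
  by rewrite o2 ?(leqW lt_yn) // /s1 update_neq //; lia.
by rewrite !nhorner /=; move: b2 b4; rewrite q1 q3; lia.
Qed.

Lemma feasible_leaf_eq f g :
  feasible f -> feasible g -> feasible (fun d => leaf_eq (f d) (g d)).
Proof.
move=> ff fg; apply: (feasible_comp (feasible_cons ff fg)
                       (g := fun d => leaf_eq (hd d) (tl d))).
apply: (@feasible_expr (fun n => EEq (EHd (EVar n)) (ETl (EVar n))) _ 6) => // d.
by case: (hd d) (tl d) => [|a|? ?] [|b|? ?] //=; try case: ifP => _ /=; lia.
Qed.

Lemma feasible_if b f g : feasible b -> feasible f -> feasible g ->
  feasible (fun d => if truth (b d) then f d else g d).
Proof.
move=> [cb [pb hb]] [cf [pf hf]] [cg [pg hg]].
exists (fun n => Seq (Assign n.+1 (EVar n)) (Seq (cb n.+1)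
         (If (EVar n.+1) (cf n) (cg n)))), (pb + pf + pg + 4%N%:P)%R.
move=> n s.
set s1 := update s n.+1 (s n).
have [s2 [t2 [e2 r2 o2 b2]]] := hb n.+1 s1.
have q2 : s2 n = s n by rewrite o2 // /s1 update_neq // neq_ltn ltnSn.
have o2' y : y < n -> s2 y = s y.
  by move=> lt_yn; rewrite o2 ?(leqW lt_yn) // /s1 update_neq //; lia.
have q1 : s1 n.+1 = s n by exact: update_same.
rewrite q1 in r2 b2.
rewrite !nhorner; move: r2; case: ifP => tb r2.
  have [s3 [t3 [e3 r3 o3 b3]]] := hf n s2.
  exists s3, (2 + (t2 + (2 + t3))); split.
  - apply: ExecSeq; first exact: ExecAssign.
    by apply: ExecSeq; [eassumption|apply: ExecIfTrue; rewrite //= r2].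
  - by rewrite r3 q2.
  - by move=> y lt_yn; rewrite o3 ?o2'.
  by move: b3; rewrite q2; lia.
have [s3 [t3 [e3 r3 o3 b3]]] := hg n s2.
exists s3, (2 + (t2 + (2 + t3))); split.
- apply: ExecSeq; first exact: ExecAssign.
  by apply: ExecSeq; [eassumption|apply: ExecIfFalse; rewrite //= r2 tb].
- by rewrite r3 q2.
- by move=> y lt_yn; rewrite o3 ?o2'.
by move: b3; rewrite q2; lia.
Qed.

(** * Iteration over a list *)

(** These are the items seen by a loop that reads the head of a register and
replaces it by its tail until it is [Nil]: an atom is true and has head [Nil],
so that the loop makes one more iteration on it. *)
Fixpoint elems (d : tree) : seq tree :=
  match d with
  | Nil => [::]
  | Atom _ => [:: Nil]
  | Cons a b => a :: elems b
  end.

Lemma elems_truth d :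
  elems d = if truth d then hd d :: elems (tl d) else [::].
Proof. by case: d. Qed.

Lemma enc_listK : cancel enc_list elems.
Proof. by elim=> //= x l ->. Qed.

Lemma tsize_hd d : tsize (hd d) <= tsize d.
Proof. by case: d => //= a b; lia. Qed.

Lemma tsize_tl d : tsize (tl d) <= tsize d.
Proof. by case: d => //= a b; lia. Qed.

Lemma size_elems d : size (elems d) <= tsize d.
Proof. by elim: d => //= a _ b IH; lia. Qed.

Section Fold.
Variables (g : tree -> tree -> tree -> tree) (q : {poly nat}).
Hypothesis g_feasible : feasible (fun d => g (hd d) (hd (tl d)) (tl (tl d))).
Hypothesis g_size : forall d a x,
  tsize (g d a x) <= tsize a + q.[(tsize d + tsize x)%N]%R.

(* The context is kept in register [n + 1], the remaining list in [n + 2] and the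
   accumulator in [n]; the step function is called in [n + 3]. *)
Let fold_loop (c : nat -> cmd) (n : nat) : cmd :=
  While (EVar n.+2)
    (Seq (Assign n.+3 (ECons (EVar n.+1) (ECons (EVar n) (EHd (EVar n.+2)))))
    (Seq (Assign n.+2 (ETl (EVar n.+2)))
    (Seq (c n.+3) (Assign n (EVar n.+3))))).

(** [X] bounds the context and the list, [B] the accumulator during the whole
loop: each iteration adds at most [q.[X + X]] to the accumulator, so that its
size stays below [B], and the argument of the step function below
[X + X + B + 2].  The test and the assignments of one iteration cost 14. *)
Lemma fold_loop_exec c (p : {poly nat}) X B n :
  (forall (n : nat) (s : store), exists (s' : store) (t : nat),
    [/\ exec (c n) s s' t,
        s' n = g (hd (s n)) (hd (tl (s n))) (tl (tl (s n))),
        forall y, y < n -> s' y = s y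
      & t + tsize (g (hd (s n)) (hd (tl (s n))) (tl (tl (s n))))
          <= p.[tsize (s n)]%R]) ->
  forall (k : nat) (s : store),
  size (elems (s n.+2)) = k -> tsize (s n.+1) <= X -> tsize (s n.+2) <= X ->
  tsize (s n) + k * q.[(X + X)%N]%R <= B ->
  exists (s' : store) (t : nat),
    [/\ exec (fold_loop c n) s s' t,
        s' n = foldl (g (s n.+1)) (s n) (elems (s n.+2)),
        forall y, y < n -> s' y = s y,
        tsize (s' n) <= B
      & t <= k * (p.[(X + X + B + 2)%N]%R + 14) + 2].
Proof.
move=> hc; elim=> [|k IH] s sz leX leX' leB.
  have Nt : truth (s n.+2) = false.
    by move: sz; rewrite elems_truth; case: truth.
  exists s, 2; split => //; first by apply: ExecWhileFalse; rewrite /= Nt.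
    by rewrite elems_truth Nt.
  by move: leB; rewrite mul0n addn0.
have Tt : truth (s n.+2) by move: sz; rewrite elems_truth; case: truth.
rewrite elems_truth Tt /= in sz *.
set D := Cons (s n.+1) (Cons (s n) (hd (s n.+2))).
set s1 := update s n.+3 D.
set s2 := update s1 n.+2 (tl (s1 n.+2)).
have E2 y : y < n.+2 -> s2 y = s y.
  by move=> lt_y; rewrite /s2 /s1 !update_neq //; lia.
have E3 : s2 n.+3 = D by rewrite /s2 update_neq /s1 ?update_same //; lia.
have [s3 [t3 [e3 r3 o3 b3]]] := hc n.+3 s2.
set s4 := update s3 n (s3 n.+3).
have E4 y : y < n.+3 -> y != n -> s4 y = s2 y.
  by move=> lt_y ney; rewrite /s4 update_neq // o3.
have q1 : s4 n.+1 = s n.+1 by rewrite E4 ?E2 //; lia.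
have q2 : s4 n.+2 = tl (s n.+2).
  rewrite E4 ?/s2 ?update_same /s1 ?update_neq //; lia.
have q0 : s4 n = g (s n.+1) (s n) (hd (s n.+2)).
  by rewrite /s4 update_same r3 E3.
have szg := g_size (s n.+1) (s n) (hd (s n.+2)).
have leq_q : q.[(tsize (s n.+1) + tsize (hd (s n.+2)))%N]%R <= q.[(X + X)%N]%R.
  by apply: horner_mono; rewrite leq_add // (leq_trans (tsize_hd _)).
have [||||s5 [t5 [e5 r5 o5 b5 u5]]] := IH s4.
- by rewrite q2; case: sz.
- by rewrite q1.
- by rewrite q2 (leq_trans (tsize_tl _)).
- rewrite q0; apply: leq_trans leB; rewrite mulSn addnA leq_add2r.
  by apply: leq_trans szg _; rewrite leq_add2l.
exists s5, (2 + (7 + (3 + (t3 + 2))) + t5); split => //.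
- apply: ExecWhileTrue e5 => //.
  apply: ExecSeq; first exact: ExecAssign.
  apply: ExecSeq; first exact: ExecAssign.
  by apply: ExecSeq; [exact: e3|exact: ExecAssign].
- by rewrite r5 q0 q1 q2.
- by move=> y lt_y; rewrite o5 // E4 ?E2 //; lia.
have : p.[tsize (s2 n.+3)]%R <= p.[(X + X + B + 2)%N]%R.
  apply: horner_mono; rewrite E3 /=; have := tsize_hd (s n.+2); lia.
by rewrite mulSn; lia.
Qed.

Lemma feasible_fold_raw :
  feasible (fun d => foldl (g (hd d)) (tl (tl d)) (elems (hd (tl d)))).
Proof.
have [c [p hc]] := g_feasible.
exists (fun n => Seq (Assign n.+1 (EHd (EVar n)))
          (Seq (Assign n.+2 (EHd (ETl (EVar n))))
          (Seq (Assign n (ETl (ETl (EVar n)))) (fold_loop c n)))).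
have [b eb] : exists b : {poly nat}, forall x, b.[x]%R = x + x * q.[(x + x)%N]%R.
  by exists ('X + 'X * (q \Po ('X + 'X)))%R => x; rewrite !nhorner.
(* The accumulator starts below [X] and at most [X] iterations take place, whence
   the bound [b.[X]] on its size. *)
exists ('X * ((p \Po ('X + 'X + b + 2%N%:P)) + 14%N%:P) + b + 13%N%:P)%R => n s.
set s1 := update s n.+1 (hd (s n)).
set s2 := update s1 n.+2 (hd (tl (s1 n))).
set s3 := update s2 n (tl (tl (s2 n))).
have q1 : s1 n = s n by rewrite /s1 update_neq //; lia.
have q2 : s2 n = s n by rewrite /s2 update_neq ?q1 //; lia.
have r0 : s3 n = tl (tl (s n)) by rewrite /s3 update_same q2.
have r1 : s3 n.+1 = hd (s n).
  by rewrite /s3 /s2 /s1 2?update_neq ?update_same //; lia.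
have r2 : s3 n.+2 = hd (tl (s n)).
  by rewrite /s3 /s2 update_neq ?update_same ?q1 //; lia.
pose X := tsize (s n); pose k := size (elems (s3 n.+2)).
have le2 : tsize (s3 n.+2) <= X.
  by rewrite r2 (leq_trans (tsize_hd _)) ?tsize_tl.
have lek : k <= X by exact: leq_trans (size_elems _) le2.
have [||s4 [t4 [e4 h4 o4 b4 u4]]] :=
    @fold_loop_exec c p X b.[X]%R n hc k s3 erefl _ le2.
- by rewrite r1 tsize_hd.
- rewrite eb r0 leq_add ?leq_mul2r ?lek ?orbT //.
  by rewrite (leq_trans (tsize_tl _)) ?tsize_tl.
exists s4, (3 + (4 + (4 + t4))); split.
- do 3! [apply: ExecSeq; first exact: ExecAssign]; exact: e4.
- by rewrite h4 r0 r1 r2.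
- move=> y lt_y; rewrite o4 // /s3 /s2 /s1 !update_neq //; lia.
rewrite h4 r0 r1 r2 in b4; rewrite -/k in u4.
rewrite !nhorner -/X.
have := leq_mul lek (leqnn (p.[(X + X + b.[X]%R + 2)%N]%R + 14)).
by move: u4 b4; lia.
Qed.

End Fold.

(** Without the additive size bound, iterating a polynomial-time step could double
the accumulator each time and take exponential time. *)
Lemma feasible_fold (g : tree -> tree -> tree -> tree) (l a : tree -> tree) :
  feasible (fun d => g (hd d) (hd (tl d)) (tl (tl d))) ->
  (exists q : {poly nat}, forall d b x,
      tsize (g d b x) <= tsize b + q.[(tsize d + tsize x)%N]%R) ->
  feasible l -> feasible a ->
  feasible (fun d => foldl (g d) (a d) (elems (l d))).
Proof.
move=> fg [q gq] fl fa; have fd := feasible_cons feasible_id (feasible_cons fl fa).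
exact: (feasible_comp fd (feasible_fold_raw fg gq)).
Qed.

(** * Booleans and lists *)

Definition feasible_seq (l : tree -> seq tree) : Prop :=
  feasible (fun d => enc_list (l d)).

Definition of_bool (b : bool) : tree := if b then Cons Nil Nil else Nil.

Lemma truth_of_bool b : truth (of_bool b) = b.
Proof. by case: b. Qed.

Definition feasible_bool (b : tree -> bool) : Prop :=
  feasible (fun d => of_bool (b d)).

Lemma feasible_ifb b f g : feasible_bool b -> feasible f -> feasible g ->
  feasible (fun d => if b d then f d else g d).
Proof.
move=> fb ff fg; apply: feasible_ext (feasible_if fb ff fg) => d.
by rewrite truth_of_bool.
Qed.

Lemma feasible_truth f : feasible f -> feasible_bool (fun d => truth (f d)).
Proof.
move=> ff; apply: feasible_if => //; last exact: feasible_nil.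
exact: feasible_cons feasible_nil feasible_nil.
Qed.

Lemma feasible_not b : feasible_bool b -> feasible_bool (fun d => ~~ b d).
Proof.
move=> fb; have ft := feasible_cons feasible_nil feasible_nil.
apply: feasible_ext (feasible_ifb fb feasible_nil ft) => d.
by case: (b d).
Qed.

Lemma feasible_and b1 b2 : feasible_bool b1 -> feasible_bool b2 ->
  feasible_bool (fun d => b1 d && b2 d).
Proof.
move=> f1 f2; apply: feasible_ext (feasible_ifb f1 f2 feasible_nil) => d.
by case: (b1 d).
Qed.

Lemma feasible_or b1 b2 : feasible_bool b1 -> feasible_bool b2 ->
  feasible_bool (fun d => b1 d || b2 d).
Proof.
move=> f1 f2; apply: feasible_ext (feasible_ifb f1 f1 f2) => d.
by case: (b1 d).
Qed.

Lemma feasible_foldl (g : tree -> tree -> tree -> tree) l a :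
  feasible (fun d => g (hd d) (hd (tl d)) (tl (tl d))) ->
  (exists q : {poly nat}, forall d b x,
      tsize (g d b x) <= tsize b + q.[(tsize d + tsize x)%N]%R) ->
  feasible_seq l -> feasible a ->
  feasible (fun d => foldl (g d) (a d) (l d)).
Proof.
move=> fg gq fl fa; apply: feasible_ext (feasible_fold fg gq fl fa) => d.
by rewrite enc_listK.
Qed.

(** The only way to extend a list in a loop is at its front, hence the
reversals in the lemmas that follow. *)
Definition push (l : seq tree) (d : tree) : tree :=
  foldl (fun b x => Cons x b) d l.

Lemma push_enc l1 l2 : push l1 (enc_list l2) = enc_list (catrev l1 l2).
Proof. by elim: l1 l2 => //= x l1 IH l2; apply: (IH (x :: l2)). Qed.

Lemma tsize_push l d : tsize (push l d) <= tsize d + tsize (enc_list l).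
Proof.
by elim: l d => [|x l IH] d //=; [lia | have /= := IH (Cons x d); lia].
Qed.

Lemma feasible_push l f : feasible_seq l -> feasible f ->
  feasible (fun d => push (l d) (f d)).
Proof.
move=> fl ff; apply: feasible_foldl => //.
  apply: feasible_cons; first exact/feasible_tl/feasible_tl/feasible_id.
  exact/feasible_hd/feasible_tl/feasible_id.
by exists ('X + 1%N%:P)%R => d b x; rewrite !nhorner /=; lia.
Qed.

Lemma feasible_nils : feasible_seq (fun=> [::]).
Proof. exact: feasible_nil. Qed.

Lemma feasible_conss f l : feasible f -> feasible_seq l ->
  feasible_seq (fun d => f d :: l d).
Proof. exact: feasible_cons. Qed.

Lemma feasible_rev l : feasible_seq l -> feasible_seq (fun d => rev (l d)).
Proof.
move=> fl; apply: feasible_ext (feasible_push fl feasible_nils) => d.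
exact: push_enc.
Qed.

Lemma feasible_cat l1 l2 : feasible_seq l1 -> feasible_seq l2 ->
  feasible_seq (fun d => l1 d ++ l2 d).
Proof.
move=> f1 f2; apply: feasible_ext (feasible_push (feasible_rev f1) f2) => d.
by rewrite push_enc catrevE revK.
Qed.

Lemma feasible_elems f : feasible f -> feasible_seq (fun d => elems (f d)).
Proof.
move=> ff.
suff fr : feasible_seq (fun d => rev (elems (f d))).
  by apply: feasible_ext (feasible_rev fr) => d; rewrite revK.
apply: (@feasible_ext (fun d => foldl (fun b x => Cons x b) Nil (elems (f d)))).
  by move=> d; apply: (push_enc _ [::]).
apply: (@feasible_fold (fun _ b x => Cons x b) _ (fun=> Nil)) => //;
  last exact: feasible_nil.
  apply: feasible_cons; first exact/feasible_tl/feasible_tl/feasible_id.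
  exact/feasible_hd/feasible_tl/feasible_id.
by exists ('X + 1%N%:P)%R => d b x; rewrite !nhorner /=; lia.
Qed.

(** The elements of [F d x] are pushed one by one on an accumulator, whose growth
in one iteration is the size of [F d x] and is independent of the accumulator.
Maps and filters are special cases, and a quantifier over a list amounts to the
emptiness of a filtered list. *)
Lemma feasible_flatmap (F : tree -> tree -> seq tree) l :
  feasible_seq (fun d => F (hd d) (tl d)) -> feasible_seq l ->
  feasible_seq (fun d => flatten [seq F d x | x <- l d]).
Proof.
move=> fF fl.
suff fr : feasible_seq (fun d => rev (flatten [seq F d x | x <- l d])).
  by apply: feasible_ext (feasible_rev fr) => d; rewrite revK.
apply: (@feasible_ext (fun d => foldl (fun b x => push (F d x) b) Nil (l d))).
  move=> d; rewrite /rev -[Nil]/(enc_list [::]).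
  by elim: (l d) [::] => //= x r IH a; rewrite push_enc IH catrev_catl.
apply: (feasible_foldl (g := fun d b x => push (F d x) b)) => //;
  last exact: feasible_nil.
- apply: feasible_push; last exact/feasible_hd/feasible_tl/feasible_id.
  have fx := feasible_tl (feasible_tl feasible_id).
  exact: (feasible_comp (feasible_cons (feasible_hd feasible_id) fx) fF).
- have [q sq] := feasible_size fF.
  exists (q \Po ('X + 1%N%:P))%R => d b x; rewrite !nhorner addn1.
  apply: leq_trans (tsize_push _ _) _; rewrite leq_add2l.
  exact: (sq (Cons d x)).
Qed.

Lemma feasible_map (F : tree -> tree -> tree) l :
  feasible (fun d => F (hd d) (tl d)) -> feasible_seq l ->
  feasible_seq (fun d => [seq F d x | x <- l d]).
Proof.
move=> fF fl; have f1 := feasible_conss fF feasible_nils.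
apply: feasible_ext (feasible_flatmap (F := fun d x => [:: F d x]) f1 fl) => d.
by congr enc_list; elim: (l d) => //= x r ->.
Qed.

Lemma feasible_filter (P : tree -> tree -> bool) l :
  feasible_bool (fun d => P (hd d) (tl d)) -> feasible_seq l ->
  feasible_seq (fun d => [seq x <- l d | P d x]).
Proof.
move=> fP fl.
pose F d x := if P d x then [:: x] else [::].
have f1 : feasible_seq (fun d => F (hd d) (tl d)).
  have fx := feasible_conss (feasible_tl feasible_id) feasible_nils.
  apply: feasible_ext (feasible_ifb fP fx feasible_nils) => d.
  by rewrite /F; case: ifP.
apply: feasible_ext (feasible_flatmap f1 fl) => d.
by congr enc_list; elim: (l d) => //= x r ->; rewrite /F; case: ifP.
Qed.

Lemma truth_enc_list l : truth (enc_list l) = (0 < size l).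
Proof. by case: l. Qed.

Lemma feasible_has (P : tree -> tree -> bool) l :
  feasible_bool (fun d => P (hd d) (tl d)) -> feasible_seq l ->
  feasible_bool (fun d => has (P d) (l d)).
Proof.
move=> fP fl; apply: feasible_ext (feasible_truth (feasible_filter fP fl)) => d.
by rewrite truth_enc_list size_filter has_count.
Qed.

Lemma feasible_all (P : tree -> tree -> bool) l :
  feasible_bool (fun d => P (hd d) (tl d)) -> feasible_seq l ->
  feasible_bool (fun d => all (P d) (l d)).
Proof.
move=> fP fl.
have fh := feasible_has (P := fun d x => ~~ P d x) (feasible_not fP) fl.
apply: feasible_ext (feasible_not fh) => d.
by rewrite -all_predC; congr of_bool; apply: eq_all => x /=; rewrite negbK.
Qed.

(** * Paths and links as trees *)

Definition leaf_eqb (a b : tree) : bool := truth (leaf_eq a b).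

Lemma feasible_leaf_eqb f g : feasible f -> feasible g ->
  feasible_bool (fun d => leaf_eqb (f d) (g d)).
Proof. by move=> ff fg; apply/feasible_truth/feasible_leaf_eq. Qed.

(** An unordered pair is represented by a list of two atoms in [e], and a step of a
path by a pair of atoms in [a], in the order of traversal. *)
Definition joins (e a : tree) : bool :=
  (leaf_eqb (hd e) (hd a) && leaf_eqb (hd (tl e)) (tl a))
  || (leaf_eqb (hd e) (tl a) && leaf_eqb (hd (tl e)) (hd a)).

Lemma feasible_joins f g : feasible f -> feasible g ->
  feasible_bool (fun d => joins (f d) (g d)).
Proof.
move=> ff fg; rewrite /joins.
by apply: feasible_or; apply: feasible_and; apply: feasible_leaf_eqb;
  do ?[exact: ff | exact: fg | apply: feasible_hd | apply: feasible_tl].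
Qed.

(** The accumulator is a pair: the previous node of the path, as a list of length
at most one, and the steps found so far, the latest first. *)
Definition link_step (a x : tree) : tree :=
  Cons (Cons x Nil)
    (if truth (hd a) then Cons (Cons (hd (hd a)) x) (tl a) else tl a).

Definition tree_links (p : tree) : seq tree :=
  elems (tl (foldl link_step (Cons Nil Nil) (elems p))).

Lemma feasible_tree_links f : feasible f -> feasible_seq (fun d => tree_links (f d)).
Proof.
move=> ff; apply: feasible_elems; apply: feasible_tl.
apply: (feasible_fold (g := fun _ a x => link_step a x)) => //.
- have fa : feasible (fun d => hd (tl d)) by exact/feasible_hd/feasible_tl/feasible_id.
  have fx : feasible (fun d => tl (tl d)) by exact/feasible_tl/feasible_tl/feasible_id.
  apply: feasible_cons; first exact: feasible_cons fx feasible_nil.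
  apply: feasible_if; first exact: feasible_hd.
    apply: feasible_cons; last exact: feasible_tl.
    by apply: feasible_cons => //; do 2! apply: feasible_hd.
  exact: feasible_tl.
- exists ('X + 'X + 5%N%:P)%R => d b x; rewrite !nhorner /link_step /=.
  case: b => [|a|b c] /=; do 1?[by lia].
  by case: b => [|a|u v] /=; lia.
- exact: feasible_cons feasible_nil feasible_nil.
Qed.

(** Proves feasibility by following the syntax of the function; the functions that
it does not know are left as subgoals. *)
Ltac feas := cbv beta; try assumption;
  lazymatch goal with
  | |- feasible (fun d => d) => exact: feasible_id
  | |- feasible hd => exact: (feasible_hd feasible_id)
  | |- feasible tl => exact: (feasible_tl feasible_id)
  | |- feasible (fun d => hd _) => apply: feasible_hd; feas
  | |- feasible (fun d => tl _) => apply: feasible_tl; feas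
  | |- feasible (fun d => Cons _ _) => apply: feasible_cons; feas
  | |- feasible (fun d => enc_list _) => feas_seq
  | |- _ => idtac
  end
with feas_seq :=
  lazymatch goal with |- feasible (fun d => enc_list (@?l d)) =>
    change (feasible_seq l); feas_list end
with feas_list := cbv beta; try assumption;
  lazymatch goal with
  | |- feasible_seq (fun d => elems _) => apply: feasible_elems; feas
  | |- feasible_seq (fun d => filter _ _) =>
      apply: feasible_filter; [feas_bool|feas_list]
  | |- feasible_seq (fun d => flatten _) => apply: feasible_flatmap; feas_list
  | |- feasible_seq (fun d => tree_links _) => apply: feasible_tree_links; feas
  | |- feasible_seq (fun d => map _ _) => apply: feasible_map; [feas|feas_list]
  | |- _ => idtac
  end
with feas_bool := cbv beta; try assumption;
  lazymatch goal with
  | |- feasible_bool (fun d => _ && _) => apply: feasible_and; feas_bool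
  | |- feasible_bool (fun d => ~~ _) => apply: feasible_not; feas_bool
  | |- feasible_bool (fun d => has _ _) =>
      apply: feasible_has; [feas_bool|feas_list]
  | |- feasible_bool (fun d => all _ _) =>
      apply: feasible_all; [feas_bool|feas_list]
  | |- feasible_bool (fun d => truth _) => apply: feasible_truth; feas
  | |- feasible_bool (fun d => leaf_eqb _ _) => apply: feasible_leaf_eqb; feas
  | |- feasible_bool (fun d => joins _ _) => apply: feasible_joins; feas
  | |- _ => idtac
  end.

(** * The search, on trees *)

Definition tree_fibers (I : tree) : seq tree := elems (hd I).
Definition tree_llinks (I : tree) : seq tree := elems (hd (tl I)).
Definition tree_src (I : tree) : tree := hd (tl (tl I)).
Definition tree_dst (I : tree) : tree := tl (tl (tl I)).

Definition tree_uses (I p f : tree) : bool :=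
  has (fun a => has (fun l => joins (hd l) a
      && has (fun b => joins f b) (tree_links (tl l))) (tree_llinks I))
    (tree_links p).

(** Feasibility is proved for the projections of a single triple, because the
quantifiers in the body put their bound variables on top of the context. *)
Lemma feasible_uses f1 f2 f3 : feasible f1 -> feasible f2 -> feasible f3 ->
  feasible_bool (fun d => tree_uses (f1 d) (f2 d) (f3 d)).
Proof.
move=> h1 h2 h3; have h := feasible_cons h1 (feasible_cons h2 h3).
apply: (feasible_comp h
  (g := fun d => of_bool (tree_uses (hd d) (hd (tl d)) (tl (tl d))))).
rewrite -/(feasible_bool _) /tree_uses /tree_llinks; feas_bool.
Qed.

Definition tree_used (I p : tree) : seq tree :=
  [seq f <- tree_fibers I | tree_uses I p f].

(** Uniqueness as the absence of a node with two occurrences. *)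
Definition tree_uniq (p : tree) : bool :=
  all (fun x => ~~ truth (tl (enc_list [seq y <- elems p | leaf_eqb x y])))
    (elems p).

Definition tree_link (I a : tree) : bool :=
  has (fun l => joins (hd l) a) (tree_llinks I).

Definition tree_logical (I p : tree) : bool :=
  [&& truth p, leaf_eqb (hd p) (tree_src I),
      leaf_eqb (last Nil (elems p)) (tree_dst I), tree_uniq p
    & all (tree_link I) (tree_links p)].

Lemma feasible_last f : feasible f -> feasible (fun d => last Nil (elems (f d))).
Proof.
move=> ff.
apply: (@feasible_ext (fun d => foldl (fun _ x => x) Nil (elems (f d)))).
  by move=> d; elim: (elems (f d)) Nil => //= x l IH a; rewrite IH.
apply: (@feasible_fold (fun _ _ x => x) _ (fun=> Nil)) => //; first by feas.
  by exists 'X%R => d b x; rewrite !nhorner; lia.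
exact: feasible_nil.
Qed.

(** A list has at most [K] elements when its [K]-th tail is empty. *)
Definition tree_admissible (K : nat) (I p : tree) : bool :=
  tree_logical I p && ~~ truth (iter K tl (enc_list (tree_used I p))).

Lemma feasible_admissible K :
  feasible_bool (fun d => tree_admissible K (hd d) (tl d)).
Proof.
apply: feasible_and.
  rewrite /tree_logical /tree_uniq /tree_link /tree_llinks /tree_src /tree_dst.
  feas_bool.
  by apply: feasible_last; feas.
apply: feasible_not; apply: feasible_truth.
have : feasible_seq (fun d => tree_used (hd d) (tl d)).
  apply: feasible_filter; first by apply: feasible_uses; feas.
  by rewrite /tree_fibers; feas_list.
elim: K => // K IH f; apply: feasible_tl; exact: IH.
Qed.

Fixpoint words (A : Type) (k : nat) (W : seq A) : seq (seq A) :=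
  if k is k'.+1 then flatten [seq [seq x :: p | p <- words k' W] | x <- W]
  else [:: [::]].

Fixpoint words_upto (A : Type) (k : nat) (W : seq A) : seq (seq A) :=
  if k is k'.+1 then words_upto k' W ++ words k W else [:: [::]].

(** The recursion on [k] is unfolded when the program is written, so the degree of
the time bound grows with [k]: [k] has to be a constant. *)
Lemma feasible_words k W : feasible_seq W ->
  feasible_seq (fun d => map enc_list (words k (W d))).
Proof.
move=> fW; elim: k => [|k IH].
  exact: feasible_conss feasible_nil feasible_nils.
apply: (@feasible_ext (fun d => enc_list (flatten
  [seq [seq Cons x p | p <- map enc_list (words k (W d))] | x <- W d]))).
  move=> d; congr enc_list => /=; rewrite map_flatten -map_comp; congr flatten.
  by apply: eq_map => x /=; rewrite -!map_comp.
apply: (feasible_flatmap (F := fun d x =>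
  [seq Cons x p | p <- map enc_list (words k (W d))])) => //.
apply: (feasible_map (F := fun d p => Cons (tl d) p)); first by feas.
exact: (feasible_comp (feasible_hd feasible_id) IH).
Qed.

Lemma feasible_words_upto k W : feasible_seq W ->
  feasible_seq (fun d => map enc_list (words_upto k (W d))).
Proof.
move=> fW; elim: k => [|k IH].
  exact: feasible_conss feasible_nil feasible_nils.
apply: feasible_ext (feasible_cat IH (feasible_words k.+1 fW)) => d.
by rewrite -map_cat.
Qed.

Definition tree_nodes (I : tree) : seq tree :=
  flatten [seq elems f | f <- tree_fibers I].

Definition tree_candidates (K : nat) (I : tree) : seq tree :=
  [seq p <- map enc_list (words_upto (2 * K) (tree_nodes I))
     | tree_admissible K I p].

Definition tree_survivable (I S : tree) : bool :=
  all (fun f => has (fun p => ~~ tree_uses I p f) (elems S)) (tree_fibers I).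

Definition tree_solutions (K : nat) (I : tree) : seq tree :=
  [seq S <- map enc_list (words_upto K.+1 (tree_candidates K I))
     | tree_survivable I S].

Definition tree_answer (K : nat) (I : tree) : tree :=
  if truth (enc_list (tree_solutions K I)) then
    Cons (hd (enc_list (tree_solutions K I))) Nil
  else Nil.

Lemma feasible_answer K : feasible (tree_answer K).
Proof.
have fF : feasible_seq tree_fibers by rewrite /tree_fibers; feas_list.
have fC : feasible_seq (tree_candidates K).
  apply: (feasible_filter (feasible_admissible K)).
  by apply: feasible_words_upto; rewrite /tree_nodes; feas_list.
have fS : feasible_seq (tree_solutions K).
  apply: feasible_filter; last exact: feasible_words_upto.
  rewrite /tree_survivable /tree_fibers; feas_bool.
  by apply: feasible_uses; feas.
apply: feasible_if => //; last exact: feasible_nil.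
exact: feasible_cons (feasible_hd fS) feasible_nil.
Qed.

(** * Words *)

Section Words.
Variable A : eqType.
Implicit Types (W : seq A) (p : seq A).

Lemma mem_words k W p : (p \in words k W) = (size p == k) && all (mem W) p.
Proof.
elim: k p => [|k IH] p; first by rewrite inE; case: p.
apply/flatten_mapP/idP => [[x xW /mapP[q]]|].
  by rewrite IH => /andP[/eqP<- qW] ->; rewrite /= eqxx xW.
case: p => // x q /= /andP[sq /andP[xW qW]].
by exists x => //; apply/map_f; rewrite IH -eqSS sq.
Qed.

Lemma mem_words_upto k W p :
  (p \in words_upto k W) = (size p <= k) && all (mem W) p.
Proof.
elim: k => [|k IH]; first by rewrite inE; case: p.
by rewrite mem_cat IH mem_words -andb_orl [in RHS]leq_eqVlt orbC.
Qed.

(** This is why the first solution found is one of minimum cardinality. *)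
Lemma words_upto_sorted k W :
  pairwise (fun p q => size p <= size q) (words_upto k W).
Proof.
elim: k => // k IH; rewrite [words_upto _ _]/(_ ++ words k.+1 W) pairwise_cat IH.
apply/andP; split.
  apply/allrelP => p q; rewrite mem_words_upto => /andP[le_p _].
  by rewrite mem_words => /andP[/eqP-> _]; apply: leqW.
suff : {in words k.+1 W &, forall p q, size p <= size q}.
  move=> h; apply/(pairwiseP [::]) => i j ? ? _.
  by apply: h; apply: mem_nth.
by move=> p q; rewrite !mem_words => /andP[/eqP-> _] /andP[/eqP-> _].
Qed.

End Words.

Lemma words_map (A B : Type) (h : A -> B) k W :
  words k (map h W) = map (map h) (words k W).
Proof.
elim: k => //= k IH; rewrite IH map_flatten -!map_comp; congr flatten.
by apply: eq_map => x /=; rewrite -!map_comp.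
Qed.

Lemma words_upto_map (A B : Type) (h : A -> B) k W :
  words_upto k (map h W) = map (map h) (words_upto k W).
Proof.
elim: k => //= k IH.
by rewrite map_cat -IH -[RHS]/(_ ++ map _ (words k.+1 W)) -words_map.
Qed.

(** * Nodes of a path *)

Section Links.
Variable V : finType.
Implicit Types (E : {set {set V}}) (p : seq V).

Definition consec p : seq (V * V) := if p is x :: q then pairmap pair x q else [::].

Lemma path_links_consec p :
  path_links p = [seq [set a.1; a.2] | a <- consec p].
Proof. by case: p => //= x q; elim: q x => //= y q IH x; rewrite IH. Qed.

Lemma path_links_cover p x :
  1 < size p -> x \in p -> exists2 e, e \in path_links p & x \in e.
Proof.
case: p => // y [//|z q] _; rewrite inE => /predU1P[->|].
  by exists [set y; z]; rewrite /= !inE eqxx.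
elim: q y z => [|u q IH] y z.
  by rewrite inE => /eqP->; exists [set y; z]; rewrite /= !inE eqxx ?orbT.
rewrite inE => /predU1P[->|xq].
  by exists [set y; z]; rewrite /= !inE eqxx ?orbT.
by have [e ep xe] := IH z u xq; exists e => //; rewrite inE ep orbT.
Qed.

Lemma is_path_cover E x y p :
  is_path E x y p -> x != y -> {subset p <= cover [set e in E | e \in path_links p]}.
Proof.
case: p => // x' q /and4P[/eqP-> /eqP ly _ /allP linkE] neq_xy z zp.
have [|e ep ze] := path_links_cover _ zp.
  by case: q ly {zp linkE} => //= xy; rewrite xy eqxx in neq_xy.
by apply/bigcupP; exists e => //; rewrite inE ep andbT; apply: linkE.
Qed.

Lemma card_cover_links E : simple_graph E -> #|cover E| <= 2 * #|E|.
Proof.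
move=> sE; apply: leq_trans (leq_card_cover E) _.
have /eq_leq/leq_trans-> // : \sum_(e in E) #|e| = \sum_(e in E) 2.
  by apply: eq_bigr => e /sE.
by rewrite sum_nat_const mulnC.
Qed.

(** A path with distinct ends visits only ends of links, and there are at most two
of these for each link. *)
Lemma is_path_size E x y p : simple_graph E ->
  is_path E x y p -> x != y -> size p <= 2 * #|E|.
Proof.
move=> sE pE neq_xy; have pU : uniq p by case: p pE => // x' q /and4P[].
have /card_uniqP <- := pU.
apply: leq_trans (subset_leq_card _) (card_cover_links sE).
apply/subsetP => z /(is_path_cover pE neq_xy) /bigcupP[e].
by rewrite inE => /andP[eE _] ze; apply/bigcupP; exists e.
Qed.

Lemma is_path_ends E x y p : is_path E x y p -> (x \in p) && (y \in p).
Proof.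
by case: p => // x' q /and4P[/eqP-> /eqP<- _ _]; rewrite mem_head mem_last.
Qed.

End Links.

(** * Correctness of the search *)

Section Correctness.
Variables (N : layered_network) (K : nat).
Implicit Types (p : seq (node N)) (S : seq (seq (node N))).

Lemma llink_path e : e \in llinks N ->
  exists i j : node N,
    [/\ e = [set i; j], i != j & is_path (fibers N) i j (routing e)].
Proof.
move=> eL; have [i [j [ee pr]]] := routingP eL; exists i, j; split => //.
by have := llinks_simple eL; rewrite {1}ee cards2; case: (i =P j).
Qed.

Lemma llink_ends e x : e \in llinks N -> x \in e -> x \in routing e.
Proof.
move=> eL; have [i [j [ee _ pr]]] := llink_path eL.
by have /andP[ir jr] := is_path_ends pr; rewrite {1}ee => /set2P[]->.
Qed.

(** Each node of a logical path is an end of a logical link on it, and the ends of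
a logical link lie on the fibers of its lightpath. *)
Lemma logical_path_used p :
  logical_path p -> {subset p <= cover (used_fibers p)}.
Proof.
move=> pl x /(is_path_cover pl (src_neq_dst N)) /bigcupP[e].
rewrite inE => /andP[eL ep] xe.
have [i [j [_ neq_ij pr]]] := llink_path eL.
have /bigcupP[f] := is_path_cover pr neq_ij (llink_ends eL xe).
rewrite inE => /andP[fF fr] xf; apply/bigcupP; exists f => //.
by rewrite inE fF; apply/hasP; exists e.
Qed.

Lemma admissible_size p : admissible K p -> size p <= 2 * K.
Proof.
case/andP => pl le_pK; have pU : uniq p by case: p pl {le_pK} => // x q /and4P[].
have /card_uniqP <- := pU.
have sU : simple_graph (used_fibers p).
  by move=> f; rewrite inE => /andP[/fibers_simple].
apply: leq_trans (subset_leq_card _) (leq_trans (card_cover_links sU) _).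
  exact/subsetP/logical_path_used.
by rewrite leq_mul2l.
Qed.

Definition fiber_nodes : seq (node N) :=
  flatten [seq enum f | f : {set node N} <- enum (fibers N)].

Lemma admissible_nodes p : admissible K p -> all (mem fiber_nodes) p.
Proof.
case/andP => pl _; apply/allP => x /(logical_path_used pl) /bigcupP[f].
rewrite inE => /andP[fF _] xf; apply/flatten_mapP; exists f => //.
  by rewrite mem_enum.
by rewrite mem_enum.
Qed.

Definition candidates : seq (seq (node N)) :=
  [seq p <- words_upto (2 * K) fiber_nodes | admissible K p].

Lemma mem_candidates p : (p \in candidates) = admissible K p.
Proof.
rewrite mem_filter mem_words_upto; apply/andb_idr => pa.
by rewrite admissible_size ?admissible_nodes.
Qed.

Definition survivableb S : bool :=
  all (fun f => has (fun p => survives p f) S) (enum (fibers N)).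

Lemma survivableP S : reflect (survivable S) (survivableb S).
Proof.
apply: (iffP allP) => h f fF; first by apply/hasP/h; rewrite mem_enum.
by apply/hasP/h; rewrite -mem_enum.
Qed.

Definition solutions : seq (seq (seq (node N))) :=
  [seq S <- words_upto K.+1 candidates | survivableb S].

Lemma solutionsP S :
  reflect [/\ size S <= K.+1, all (admissible K) S & survivable S] (S \in solutions).
Proof.
rewrite mem_filter mem_words_upto (eq_all mem_candidates).
by apply: (iffP and3P) => -[h1 h2 h3]; split => //; apply/survivableP.
Qed.

(** When [S] has more than [K + 1] elements, it suffices to keep its first path [P]
and, for each fiber used by [P], one path of [S] avoiding that fiber. *)
Lemma small_survivable S : all (admissible K) S -> survivable S ->
  exists2 S', S' \in solutions & size S' <= size S.
Proof.
case: S => [|P S] aS sS; first by exists [::] => //; apply/solutionsP.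
have [leS|gtS] := leqP (size (P :: S)) K.+1.
  by exists (P :: S) => //; apply/solutionsP.
pose avoid f := nth P (P :: S) (find (fun Q => survives Q f) (P :: S)).
have av f : f \in fibers N -> avoid f \in P :: S /\ survives (avoid f) f.
  move=> /sS[Q QS Qf]; have hQ : has (fun Q => survives Q f) (P :: S).
    by apply/hasP; exists Q.
  by split; [rewrite mem_nth // -has_find | apply: (nth_find P hQ)].
have /andP[/andP[_ lePK] _] := aS.
exists (P :: [seq avoid f | f <- enum (used_fibers P)]); last first.
  by rewrite /= size_map -cardE; exact: leq_ltn_trans lePK (ltnW gtS).
have usedF f : f \in used_fibers P -> f \in fibers N by rewrite inE => /andP[].
apply/solutionsP; split.
- by rewrite /= size_map -cardE.
- apply/allP => Q; rewrite inE => /predU1P[->|/mapP[f]].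
    exact: (allP aS _ (mem_head _ _)).
  by rewrite mem_enum => /usedF/av[fS _] ->; apply: (allP aS).
move=> f fF; have [fP|fP] := boolP (f \in used_fibers P); last first.
  by exists P; rewrite ?mem_head.
by exists (avoid f); [rewrite inE map_f ?orbT ?mem_enum | case: (av f fF)].
Qed.

(** A solution of minimum length is duplicate-free, since removing duplicates
preserves survivability.  When there are no fibers the empty set is survivable,
and it is the first solution. *)
Lemma ohead_solutions_correct : restricted_MSP_answer K (ohead solutions).
Proof.
have sorted_sol : pairwise (fun S S' => size S <= size S') solutions.
  by rewrite pairwise_filter // words_upto_sorted.
have sub := small_survivable.
case E : solutions sorted_sol => [|Ps r] /=.
  by move=> _ S [_ aS /(sub _ aS)[S']]; rewrite E.
case/andP => /allP minPs _.
have Pmin S : all (admissible K) S -> survivable S -> size Ps <= size S.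
  move=> aS /(sub _ aS)[S']; rewrite E inE => /predU1P[-> //|S'r le].
  exact: leq_trans (minPs _ S'r) le.
have [_ aPs sPs] : [/\ size Ps <= K.+1, all (admissible K) Ps & survivable Ps].
  by apply/solutionsP; rewrite E mem_head.
split=> [|S [_ aS sS]]; last exact: Pmin.
split=> //; rewrite -[uniq _]negbK -ltn_size_undup -leqNgt; apply: Pmin.
  by rewrite all_undup.
by move=> f /sPs[P PPs Pf]; exists P; rewrite ?mem_undup.
Qed.

End Correctness.

(** * The search on an encoded network *)

Lemma truth_iter_tl k l : truth (iter k tl (enc_list l)) = (k < size l).
Proof.
elim: k l => [|k IH] [|x l] //; rewrite iterSr /= -/(enc_list _); last exact: IH.
exact: (IH [::]).
Qed.

Lemma filter_map_eq (A B : Type) (h : A -> B) (a : pred B) (b : pred A) s :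
  (forall x, a (h x) = b x) -> filter a (map h s) = map h (filter b s).
Proof. by move=> ab; rewrite filter_map; congr map; apply: eq_filter. Qed.

Section Encoding.
Variables (N : layered_network) (K : nat).
Implicit Types (p : seq (node N)) (e f : {set node N}).

(** The part of an encoded network that the search reads; its size is polynomial in
the number of fibers, which is not true of [enc_network]. *)
Definition enc_instance : tree :=
  Cons (enc_list (map (@enc_set N) (enum (fibers N))))
    (Cons (enc_list (map (@enc_llink N) (enum (llinks N))))
       (Cons (enc_node (src N)) (enc_node (dst N)))).

Definition enc_link (a : node N * node N) : tree :=
  Cons (enc_node a.1) (enc_node a.2).

Lemma leaf_eqb_node (x y : node N) :
  leaf_eqb (enc_node x) (enc_node y) = (x == y).
Proof.
rewrite /leaf_eqb /=; have -> : (enum_rank x == enum_rank y :> nat) = (x == y).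
  by rewrite val_eqE (inj_eq enum_rank_inj).
by case: eqP.
Qed.

Lemma joins_link e a :
  #|e| = 2 -> joins (enc_set e) (enc_link a) = (e == [set a.1; a.2]).
Proof.
case: a => x y; rewrite cardE /enc_set => se.
have : uniq (enum e) := enum_uniq _; have : e = [set z in enum e].
  by apply/setP => z; rewrite inE mem_enum.
case: (enum e) se => [|u [|v []]] // _ {1}->; rewrite /= inE andbT => neq_uv.
rewrite /joins /= !leaf_eqb_node; apply/idP/eqP.
  by move/orP => [] /andP[/eqP-> /eqP->]; apply/setP => z; rewrite !inE ?orbF // orbC.
move/setP => h; have := h u; have := h v.
rewrite !inE !eqxx !orbT => /esym/orP[]/eqP ev /esym/orP[]/eqP eu;
  by move: neq_uv; rewrite eu ev ?eqxx ?orbT.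
Qed.

Lemma elems_enc_path p : elems (enc_path p) = map (@enc_node N) p.
Proof. exact: enc_listK. Qed.

Lemma tree_links_path p : tree_links (enc_path p) = rev (map enc_link (consec p)).
Proof.
rewrite /tree_links elems_enc_path; case: p => // x q /=.
rewrite /rev.
suff h l : elems (tl (foldl link_step (Cons (Cons (enc_node x) Nil) (enc_list l))
    (map (@enc_node N) q))) = catrev (map enc_link (pairmap pair x q)) l.
  exact: (h [::]).
elim: q x l => [|y q IH] x l /=; first exact: enc_listK.
exact: (IH y (enc_link (x, y) :: l)).
Qed.

Lemma has_tree_links P p :
  has P (tree_links (enc_path p))
    = has (fun a => P (enc_link a)) (consec p).
Proof. by rewrite tree_links_path has_rev has_map. Qed.

Lemma all_tree_links P p :
  all P (tree_links (enc_path p))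
    = all (fun a => P (enc_link a)) (consec p).
Proof. by rewrite tree_links_path all_rev all_map. Qed.

Lemma tree_link_instance a :
  tree_link enc_instance (enc_link a) = ([set a.1; a.2] \in llinks N).
Proof.
rewrite /tree_link /tree_llinks /= enc_listK has_map; apply/hasP/idP => [[e]|eL].
  rewrite mem_enum => eL; rewrite /= joins_link; last exact: llinks_simple.
  by move/eqP <-.
exists [set a.1; a.2]; first by rewrite mem_enum.
by rewrite /= joins_link //; apply: llinks_simple.
Qed.

Lemma tree_links_instance p :
  all (tree_link enc_instance) (tree_links (enc_path p))
    = all (mem (llinks N)) (path_links p).
Proof.
rewrite all_tree_links path_links_consec all_map; apply: eq_all => a.
exact: tree_link_instance.
Qed.

(** [used_fibers] looks up the routing of all links of [p], whereas the search only
knows the routing of logical links: they agree when all links are logical. *)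
Lemma tree_uses_instance p f :
  f \in fibers N -> all (mem (llinks N)) (path_links p) ->
  tree_uses enc_instance (enc_path p) (enc_set f) = (f \in used_fibers p).
Proof.
move=> fF /allP pL; rewrite inE fF /tree_uses has_tree_links.
have routeE e : has (fun b => joins (enc_set f) b) (tree_links (tl (enc_llink e)))
    = (f \in path_links (routing e)).
  rewrite has_tree_links path_links_consec.
  apply/hasP/mapP => -[a ar]; first
    by rewrite joins_link ?fibers_simple // => /eqP; exists a.
  by move=> fa; exists a; rewrite // joins_link ?fibers_simple // fa.
have pE : path_links p = [seq [set a.1; a.2] | a <- consec p] := path_links_consec p.
rewrite pE has_map; apply: eq_in_has => a ap.
have aL : [set a.1; a.2] \in llinks N by apply: pL; rewrite pE; apply: map_f ap.
rewrite /tree_llinks /= enc_listK has_map; apply/hasP/idP => [[e]|fr].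
  rewrite mem_enum => eL; rewrite /= joins_link; last exact: llinks_simple.
  by move=> /andP[/eqP<-]; rewrite routeE.
exists [set a.1; a.2]; first by rewrite mem_enum.
rewrite /= joins_link ?eqxx; last exact: llinks_simple.
by rewrite routeE.
Qed.

Lemma tree_uniq_path p : tree_uniq (enc_path p) = uniq p.
Proof.
rewrite /tree_uniq elems_enc_path all_map.
have cntE x : truth (tl (enc_list
    [seq y <- map (@enc_node N) p | leaf_eqb (enc_node x) y]))
    = (1 < count_mem x p).
  rewrite (truth_iter_tl 1) size_filter count_map; congr (_ < _).
  by apply: eq_count => y; rewrite /= leaf_eqb_node eq_sym.
apply/allP/idP => [h|pU x xp]; last by rewrite /= cntE count_uniq_mem // xp.
apply: count_mem_uniq => x; have [xp|/count_memPn//] := boolP (x \in p).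
have /= := h x xp; rewrite cntE -leqNgt => le1.
by apply/eqP; rewrite eqn_leq le1 -has_count has_pred1.
Qed.

Lemma tree_logical_path p : tree_logical enc_instance (enc_path p) = logical_path p.
Proof.
rewrite /tree_logical tree_links_instance tree_uniq_path elems_enc_path.
case: p => // x q; rewrite /logical_path /is_path.
rewrite -[last _ _]/(last (enc_node x) (map _ q)) last_map.
by rewrite /tree_src /tree_dst /= !leaf_eqb_node.
Qed.

Lemma logical_links p : logical_path p -> all (mem (llinks N)) (path_links p).
Proof. by case: p => // x q /and4P[]. Qed.

Lemma tree_admissible_path p :
  tree_admissible K enc_instance (enc_path p) = admissible K p.
Proof.
rewrite /tree_admissible tree_logical_path /admissible; apply: andb_id2l => pl.
rewrite truth_iter_tl -leqNgt; congr (_ <= _).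
rewrite /tree_used /tree_fibers /= enc_listK filter_map size_map cardE.
apply/perm_size/uniq_perm; [exact/filter_uniq/enum_uniq|exact: enum_uniq|move=> f].
rewrite mem_filter !mem_enum /=.
have [fF|/negPf fF] := boolP (f \in fibers N); last by rewrite andbF inE fF.
by rewrite andbT tree_uses_instance // logical_links.
Qed.

Lemma tree_candidates_instance :
  tree_candidates K enc_instance = map (@enc_path N) (candidates N K).
Proof.
have -> : tree_candidates K enc_instance =
    [seq p <- map (@enc_path N) (words_upto (2 * K) (fiber_nodes N))
       | tree_admissible K enc_instance p].
  rewrite /tree_candidates; congr filter.
  have -> : tree_nodes enc_instance = map (@enc_node N) (fiber_nodes N).
    rewrite /tree_nodes /tree_fibers /= enc_listK map_flatten -!map_comp.
    by congr flatten; apply: eq_map => f; apply: enc_listK.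
  by rewrite words_upto_map -map_comp.
exact/filter_map_eq/tree_admissible_path.
Qed.

Definition enc_paths (S : seq (seq (node N))) : tree :=
  enc_list (map (@enc_path N) S).

Lemma tree_solutions_instance :
  tree_solutions K enc_instance = map enc_paths (solutions N K).
Proof.
rewrite /tree_solutions tree_candidates_instance words_upto_map -map_comp filter_map.
congr map; apply: eq_in_filter => S; rewrite mem_words_upto => /andP[_ /allP SC].
rewrite /tree_survivable /tree_fibers /= !enc_listK all_map.
apply: eq_in_all => f; rewrite mem_enum => fF; rewrite /= has_map.
apply: eq_in_has => p /SC; rewrite inE mem_candidates => /andP[pl _].
by rewrite /= tree_uses_instance // logical_links.
Qed.

Lemma tree_answer_instance :
  tree_answer K enc_instance = enc_answer (ohead (solutions N K)).
Proof. by rewrite /tree_answer tree_solutions_instance; case: (solutions N K). Qed.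

(** * Size of the relevant part of a network *)

Lemma tsize_enc_path p : tsize (enc_path p) = (2 * size p).+1.
Proof. by elim: p => //= x p; rewrite /enc_path /= => ->; lia. Qed.

Lemma tsize_enc_list (T : Type) (h : T -> tree) (b : nat) (s : seq T) :
  all (fun x => tsize (h x) <= b) s ->
  tsize (enc_list (map h s)) <= size s * b.+1 + 1.
Proof. by elim: s => //= x s IH /andP[hx /IH]; lia. Qed.

Lemma tsize_enc_set e : #|e| = 2 -> tsize (enc_set e) = 5.
Proof. by move=> ee; rewrite tsize_enc_path -cardE ee. Qed.

(** A logical link is determined by its two ends, which are ends of fibers. *)
Lemma card_llinks : #|llinks N| <= (2 * num_fibers N) ^ 2.
Proof.
pose C := cover (fibers N).
have leC : #|C| <= 2 * num_fibers N by apply/card_cover_links/fibers_simple.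
apply: (@leq_trans #|setX C C|); last by rewrite cardsX -mulnn leq_mul.
apply: leq_trans (leq_imset_card (fun a => [set a.1; a.2]) _).
apply/subset_leq_card/subsetP => e eL.
have [i [j [ee neq_ij pr]]] := llink_path eL.
have rC x : x \in routing e -> x \in C.
  move=> /(is_path_cover pr neq_ij)/bigcupP[f]; rewrite inE => /andP[fF _] xf.
  by apply/bigcupP; exists f.
have /andP[ir jr] := is_path_ends pr.
by apply/imsetP; exists (i, j); rewrite ?inE /= ?rC.
Qed.

Lemma tsize_instance (m := num_fibers N) :
  tsize enc_instance <= 6 * m + (2 * m) ^ 2 * (4 * m + 8) + 7.
Proof.
have hF :
  tsize (enc_list (map (@enc_set N) (enum (fibers N)))) <= m * 6 + 1.
  rewrite /m /num_fibers cardE; apply: tsize_enc_list.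
  apply/allP => f; rewrite mem_enum => fF.
  by rewrite tsize_enc_set ?fibers_simple.
have hL : tsize (enc_list (map (@enc_llink N) (enum (llinks N))))
    <= (2 * m) ^ 2 * (4 * m + 8) + 1.
  apply: leq_trans (tsize_enc_list (b := 4 * m + 7) _) _.
    apply/allP => e; rewrite mem_enum => eL.
    have [i [j [_ neq_ij pr]]] := llink_path eL.
    have := is_path_size (@fibers_simple N) pr neq_ij.
    rewrite /= tsize_enc_set ?tsize_enc_path -/(num_fibers N) -/m; first by lia.
    exact: llinks_simple.
  by rewrite -cardE leq_add2r -addnS leq_mul2r card_llinks orbT.
by move: hF hL; rewrite /=; lia.
Qed.

End Encoding.

(** * The theorem *)

(** Keeps the fibers, the logical links, the source and the destination, and
skips the two lists of nodes. *)
Definition extract : expr :=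
  let v := EVar 0 in
  let l := ETl v in
  let r := ETl (ETl l) in
  ECons (EHd l) (ECons (EHd r) (ECons (EHd (ETl r)) (EHd (ETl (ETl r))))).

Theorem theorem2 (K : nat) :
  polytime_solvable
    (I := layered_network)
    (A := fun N => option (seq (seq (node N))))
    enc_network
    enc_answer
    (fun N a => restricted_MSP_answer K a)
    num_fibers.
Proof.
have [c [p hc]] := feasible_answer K.
have [b hb] : exists b : {poly nat}, forall m,
    b.[m]%R = 6 * m + (2 * m) ^ 2 * (4 * m + 8) + 7.
  exists (6%N%:P * 'X + (2%N%:P * 'X) * (2%N%:P * 'X) * (4%N%:P * 'X + 8%N%:P)
          + 7%N%:P)%R => m.
  by rewrite !nhorner mulnn.
exists (Seq (Assign 0 extract) (c 0)), ((cost extract).+1%:P + (p \Po b))%R => N.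
exists (ohead (solutions N K)).
pose s0 := update (fun=> Nil) 0 (enc_network N).
have [s [t [et rt _ bt]]] := hc 0 (update s0 0 (eval s0 extract)).
have inst : update s0 0 (eval s0 extract) 0 = enc_instance N by [].
exists ((cost extract).+1 + t); split; first exact: ohead_solutions_correct.
  exists s; split; last by rewrite rt inst tree_answer_instance.
  by apply: ExecSeq et; apply: ExecAssign.
rewrite !nhorner leq_add2l.
apply: leq_trans (leq_addr _ _) (leq_trans bt _); rewrite inst; apply: horner_mono.
by rewrite hb; apply: tsize_instance.
Qed.
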